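(* Let $n,m\ge 1$, let $\lambda>0$, let $\mathbf{w}=(w_1,\ldots,w_m)\in\mathbb{R}^m$ with $w_i>0$ for all $i$, and let $G_1,\ldots,G_m\subseteq\{1,\ldots,n\}$ be groups such that every $j\in\{1,\ldots,n\}$ belongs to at least one group. Let $k_j\ge 1$ be the number of indices $i$ with $j\in G_i$, and let $\mathbf{U}=\operatorname{diag}(\sqrt{k_1}\|\mathbf{w}\|_2,\ldots,\sqrt{k_n}\|\mathbf{w}\|_2)$. Let $\mathbf{v}\in\mathbb{R}^n$ satisfy $\|\mathbf{U}^{-1}\mathbf{v}\|_2>\lambda$. Define, for $\mathbf{x}\in\mathbb{R}^n\setminus\{\mathbf{0}\}$, $$T(\mathbf{x}):=\left(\mathbf{I}+\frac{\lambda\,\mathbf{U}^T\mathbf{U}}{\|\mathbf{U}\mathbf{x}\|_2}\right)^{-1}\mathbf{v}.$$ Then $T$ has a unique fixed point $\mathbf{x}^*\in\mathbb{R}^n\setminus\{\mathbf{0}\}$, and for every starting point $\mathbf{x}^{(0)}\in\mathbb{R}^n\setminus\{\mathbf{0}\}$ the fixed point iteration $\mathbf{x}^{(k+1)}:=T(\mathbf{x}^{(k)})$ converges to $\mathbf{x}^*$.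
   Context: $\|\cdot\|_2$ is the Euclidean norm and $\mathbf{I}$ is the $n\times n$ identity matrix. The equation $\mathbf{x}=T(\mathbf{x})$ is the first-order optimality condition, for $\mathbf{x}\ne\mathbf{0}$, of the problem $\min_{\mathbf{x}\in\mathbb{R}^n}\ \frac12\|\mathbf{x}-\mathbf{v}\|_2^2+\lambda\|\mathbf{U}\mathbf{x}\|_2$, whose minimizer is $\mathbf{0}$ when $\|\mathbf{U}^{-1}\mathbf{v}\|_2\le\lambda$. *)

(* Defs.v *)
From HB Require Import structures.
From mathcomp Require Import all_boot all_order all_algebra.
From mathcomp Require Import all_classical all_reals all_analysis.

Set Implicit Arguments.
Unset Strict Implicit.
Unset Printing Implicit Defensive.

Import Order.TTheory GRing.Theory Num.Theory.
Import numFieldNormedType.Exports.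

Local Open Scope ring_scope.

(* The norm [`|x|] that MathComp-Analysis puts on matrices is the sup norm, so
   the Euclidean norm is defined separately. *)
Definition l2norm (R : realType) (n : nat) (x : 'cV[R]_n) : R :=
  Num.sqrt (\sum_(j < n) x j 0 ^+ 2).

Definition group_count (n m : nat) (G : 'I_m -> {set 'I_n}) (j : 'I_n) : nat :=
  #|[set i : 'I_m | j \in G i]|.

Definition Umx (R : realType) (n m : nat) (w : 'cV[R]_m)
    (G : 'I_m -> {set 'I_n}) : 'M[R]_n :=
  diag_mx (\row_(j < n) (Num.sqrt (group_count G j)%:R * l2norm w)).

(* [fpmap] is total: its value at [0] is an artefact of division by zero and is
   meaningful only for [x != 0]. *)
Definition fpmap (R : realType) (n : nat) (lambda : R) (U : 'M[R]_n)
    (v x : 'cV[R]_n) : 'cV[R]_n :=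
  invmx (1%:M + (lambda / l2norm (U *m x)) *: (U^T *m U)) *m v.

(* Main.v *)
Require Import Defs.
From HB Require Import structures.
From mathcomp Require Import all_boot all_order all_algebra.
From mathcomp Require Import all_classical all_reals all_analysis.
From mathcomp Require Import ring lra.

Import Order.TTheory GRing.Theory Num.Theory.
Import numFieldNormedType.Exports.

(** Write [U = diag(d)] with [d_j > 0] and [s = |U x|_2].  The matrix inverted in
    [T] is diagonal, so [T x] depends on [x] only through the number [s]:
    [T(x)_j = s v_j / (s + lambda d_j^2)].  Hence [|U T(x)|_2 = phi(s)], where
    [phi(s) = s g(s)] and [g(s)] is the Euclidean norm of the vector with entries
    [d_j v_j / (s + lambda d_j^2)] ([gain] below), and the iteration on vectors is
    governed by the scalar iteration [s |-> phi(s)].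

    - [g] is strictly decreasing on [[0, +oo[] ([gain_decreasing]), because each
      entry shrinks as [s] grows.  Moreover [g(0) = |U^-1 v|_2 / lambda > 1] by
      hypothesis and [g(s) <= 1] for [s = |U v|_2], so [g(p) = 1] for exactly one
      [p > 0] ([gain_eq1]): [phi] has a unique positive fixed point, and this is
      what gives existence and uniqueness for [T].
    - [phi] is nondecreasing ([mul_gain_nondecreasing]), because
      [s / (s + lambda d_j^2)] increases with [s].  So [s < p] gives
      [s < phi(s) <= p], and [s > p] gives [p <= phi(s) < s]: the scalar iterates
      move monotonically towards [p] without crossing it, their limit is a fixed
      point by continuity, and it can only be [p] ([monotone_iteration_cvg]).

    The vectors [x^(k+1)] converge because they depend continuously on the
    convergent numbers [|U x^(k)|_2] ([fpmap_diag_cvg]). *)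

Local Open Scope classical_set_scope.
Local Open Scope ring_scope.

(** * The Euclidean norm *)

Lemma l2norm_ge0 {R : realType} {n} (x : 'cV[R]_n) : 0 <= l2norm x.
Proof. exact: sqrtr_ge0. Qed.

Lemma l2norm0 (R : realType) n : l2norm (0 : 'cV[R]_n) = 0.
Proof. by rewrite /l2norm big1 ?sqrtr0// => j _; rewrite mxE expr0n. Qed.

Lemma l2normZ {R : realType} {n} (t : R) (x : 'cV[R]_n) :
  0 <= t -> l2norm (t *: x) = t * l2norm x.
Proof.
move=> t0; rewrite /l2norm.
under eq_bigr => j _ do rewrite mxE exprMn.
by rewrite -mulr_sumr sqrtrM ?sqr_ge0// sqrtr_sqr ger0_norm.
Qed.

Lemma ler_sqr_norm {R : realDomainType} (x y : R) :
  (x ^+ 2 <= y ^+ 2) = (`|x| <= `|y|).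
Proof.
rewrite -[x ^+ 2]real_normK ?num_real// -[y ^+ 2]real_normK ?num_real//.
by rewrite ler_sqr ?nnegrE.
Qed.

Lemma ler_l2norm {R : realType} {n} (x y : 'cV[R]_n) :
  (forall j, `|x j 0| <= `|y j 0|) -> l2norm x <= l2norm y.
Proof.
by move=> xy; apply/ler_wsqrtr/ler_sum => j _; rewrite ler_sqr_norm.
Qed.

Lemma ltr_l2norm {R : realType} {n} (x y : 'cV[R]_n) (i : 'I_n) :
  (forall j, `|x j 0| <= `|y j 0|) -> `|x i 0| < `|y i 0| ->
  l2norm x < l2norm y.
Proof.
move=> xy xyi.
have lt_sum : \sum_(j < n) x j 0 ^+ 2 < \sum_(j < n) y j 0 ^+ 2.
  rewrite (bigD1 i)//= [ltRHS](bigD1 i)//=; apply: ltr_leD.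
    by rewrite ltNge ler_sqr_norm -ltNge.
  by apply: ler_sum => j _; rewrite ler_sqr_norm.
rewrite /l2norm ltr_sqrt//; apply: le_lt_trans lt_sum.
by apply: sumr_ge0 => j _; exact: sqr_ge0.
Qed.

Lemma l2norm_gt0 {R : realType} {n} (x : 'cV[R]_n) : (0 < l2norm x) = (x != 0).
Proof.
apply/idP/idP => [|x0]; first by apply: contraTneq => ->; rewrite l2norm0 ltxx.
have /cV0Pn[i xi0] := x0.
rewrite -(l2norm0 R n); apply: (@ltr_l2norm _ _ _ _ i) => [j|].
  by rewrite mxE normr0.
by rewrite mxE normr0 normr_gt0.
Qed.

Lemma cvg_mx_coord {R : realType} {T : Type} (F : set_system T) {FF : Filter F}
    {m n} (f : T -> 'M[R]_(m, n)) (l : 'M[R]_(m, n)) :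
  (forall i j, f t i j @[t --> F] --> l i j) -> f @ F --> l.
Proof.
move=> fl; apply/cvg_ballP => e e0.
have : \forall t \near F, forall i j, ball (l i j) e (f t i j).
  apply: filter_forall => i; apply: filter_forall => j.
  exact: (cvg_ball (fl i j)).
by apply: filterS => t H; split.
Qed.

Lemma l2norm_continuous {R : realType} {n} : continuous (@l2norm R n).
Proof.
move=> x.
apply: (@continuous_comp _ _ _ (fun y : 'cV[R]_n => \sum_(j < n) y j 0 ^+ 2)
  Num.sqrt); last exact: sqrt_continuous.
apply: (cvg_big _ (nbhs_filter x)) => [|j _]; first exact: add_continuous.
by apply: cvgM; exact: coord_continuous.
Qed.

(** * Monotone scalar iterations *)

(** Since [f] is nondecreasing and fixes [p], the iterates never cross [p]; the
    comparisons of [f s] with [s] then make them monotone, hence convergent.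
    Continuity turns the limit into a fixed point of [f], and the same strict
    comparisons leave [p] as the only positive one. *)
Lemma monotone_iteration_cvg {R : realType} (f : R -> R) (p : R) (u : nat -> R) :
  0 < p -> f p = p ->
  (forall s t : R, 0 < s -> s <= t -> f s <= f t) ->
  (forall s : R, 0 < s -> {for s, continuous f}) ->
  (forall s : R, 0 < s -> s < p -> s < f s) ->
  (forall s, p < s -> f s < s) ->
  0 < u 0%N -> (forall k, u k.+1 = f (u k)) -> u @ \oo --> p.
Proof.
move=> p0 fp f_homo f_cont f_below f_above u0 uS.
have lim_fixed (l : R) : 0 < l -> u @ \oo --> l -> f l = l.
  move=> l0 ul.
  have fu : (f \o u) @ \oo --> f l.
    by apply: continuous_cvg => //; exact: f_cont.
  have fu' : (f \o u) @ \oo --> l.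
    rewrite (_ : f \o u = [sequence u k.+1]_k) ?cvg_shiftS//.
    by apply/funext => k; rewrite /= uS.
  exact: (cvg_unique (@norm_hausdorff _ R) fu fu').
have f_ge s : 0 < s -> s <= p -> s <= f s.
  move=> s0; rewrite [s <= p]le_eqVlt => /predU1P[->|/f_below/ltW->//].
  by rewrite fp.
have f_le s : p <= s -> f s <= s.
  by rewrite [p <= s]le_eqVlt => /predU1P[<-|/f_above/ltW//]; rewrite fp.
have [u0p|pu0] := leP (u 0%N) p.
- have inv k : 0 < u k /\ u k <= p.
    elim: k => // k [uk0 ukp]; rewrite uS; split; last by rewrite -fp f_homo.
    exact: lt_le_trans (f_ge _ uk0 ukp).
  have u_nd : nondecreasing_seq u.
    apply/nondecreasing_seqP => k; have [uk0 ukp] := inv k.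
    by rewrite uS f_ge.
  have u_cvg : cvgn u.
    apply: nondecreasing_is_cvgn => //.
    by exists p => _ [k _ <-]; have [] := inv k.
  have l0 : 0 < limn u by apply: (lt_le_trans u0); exact: nondecreasing_cvgn_le.
  have lp : limn u <= p by apply: limr_le => //; near=> k; have [] := inv k.
  have fl : f (limn u) = limn u by exact: lim_fixed.
  move: lp; rewrite le_eqVlt => /predU1P[<-//|/(f_below _ l0)].
  by rewrite fl ltxx.
- have inv k : p <= u k.
    by elim: k => [|k pk]; [exact: ltW|rewrite uS -fp f_homo].
  have u_ni : nonincreasing_seq u.
    by apply/nonincreasing_seqP => k; rewrite uS f_le.
  have u_cvg : cvgn u.
    apply: nonincreasing_is_cvgn => //.
    by exists p => _ [k _ <-]; exact: inv.
  have pl : p <= limn u by apply: limr_ge => //; near=> k; exact: inv.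
  have fl : f (limn u) = limn u.
    by apply: lim_fixed => //; exact: lt_le_trans pl.
  move: pl; rewrite le_eqVlt => /predU1P[->//|/f_above].
  by rewrite fl ltxx.
Unshelve. all: by end_near.
Qed.

(** * The gain of the norm *)

(** The factor by which one step of the iteration multiplies [s = |U x|_2], for
    [a_j = lambda d_j^2] and [c = U v]. *)
Definition gain {R : realType} {n : nat} (a c : 'cV[R]_n) (s : R) : R :=
  l2norm (\col_j (c j 0 / (s + a j 0))).

Section Gain.
Context {R : realType} {n : nat} {a c : 'cV[R]_n}.
Hypothesis a_gt0 : forall j, 0 < a j 0.

Let den_gt0 (s : R) j : 0 <= s -> 0 < s + a j 0.
Proof. by move=> s0; rewrite ltr_wpDl. Qed.

Let den_ge0 (s : R) j : 0 <= s -> 0 <= s + a j 0.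
Proof. by move=> s0; apply/ltW/den_gt0. Qed.

Lemma gain_continuous (s : R) : 0 <= s -> {for s, continuous (gain a c)}.
Proof.
move=> s0; apply: (@continuous_cvg _ _ _ _ _ _ (@l2norm R n)).
  exact: l2norm_continuous.
apply: cvg_mx_coord => j k; rewrite mxE; under eq_fun do rewrite mxE.
apply: cvgM; first exact: cvg_cst.
apply: cvgV; first by rewrite gt_eqF ?den_gt0.
by apply: cvgD; [exact: cvg_id|exact: cvg_cst].
Qed.

Lemma gain_decreasing {s t : R} : c != 0 -> 0 <= s -> s < t ->
  gain a c t < gain a c s.
Proof.
move=> /cV0Pn[i ci0] s0 st.
have t0 : 0 <= t by exact/ltW/(le_lt_trans s0).
apply: (@ltr_l2norm _ _ _ _ i) => [j|]; rewrite !mxE !normrM !normfV.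
  rewrite ler_wpM2l// lef_pV2 ?posrE ?normr_gt0 ?gt_eqF ?den_gt0//.
  by rewrite !gtr0_norm ?den_gt0// lerD2r ltW.
rewrite ltr_pM2l ?normr_gt0// ltf_pV2 ?posrE ?normr_gt0 ?gt_eqF ?den_gt0//.
by rewrite !gtr0_norm ?den_gt0// ltrD2r.
Qed.

(** In coordinates [s / (s + a_j)] increases with [s], although [gain] itself
    decreases. *)
Lemma mul_gain_nondecreasing (s t : R) :
  0 <= s -> s <= t -> s * gain a c s <= t * gain a c t.
Proof.
move=> s0 st; have t0 := le_trans s0 st.
rewrite -!l2normZ//; apply: ler_l2norm => j; rewrite !mxE.
rewrite mulrCA [t * _]mulrCA !normrM ler_wpM2l//.
rewrite -!normrM !ger0_norm ?divr_ge0 ?den_ge0//.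
rewrite ler_pdivrMr ?den_gt0// mulrAC ler_pdivlMr ?den_gt0//.
have := a_gt0 j; nra.
Qed.

(** The intermediate value theorem applies between [0] and [|c|_2]: at
    [s = |c|_2] one has [s * gain s <= |c|_2] because [s / (s + a_j) <= 1]. *)
Lemma gain_eq1 : 1 < gain a c 0 -> exists2 s, 0 < s & gain a c s = 1.
Proof.
move=> gain0; pose B := l2norm c.
have B0 : 0 <= B by exact: l2norm_ge0.
have gainB : gain a c B <= 1.
  (* Dividing by B needs B != 0; if B = 0 then c = 0 and the gain vanishes. *)
  have [B_eq0|B_neq0] := eqVneq B 0.
    have c0 : c = 0.
      by apply/eqP; rewrite -[_ == _]negbK -l2norm_gt0 -/B B_eq0 ltxx.
    rewrite /gain (_ : (\col__ _) = 0) ?l2norm0//.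
    by apply/colP => j; rewrite !mxE c0 mxE mul0r.
  have Bgt0 : 0 < B by rewrite lt_def B_neq0.
  rewrite -(ler_pM2l Bgt0) mulr1 -l2normZ//; apply: ler_l2norm => j.
  rewrite !mxE mulrCA normrM ler_piMr// ger0_norm ?divr_ge0 ?den_ge0//.
  by rewrite ler_pdivrMr ?den_gt0// mul1r lerDl ltW.
have [s] : exists2 s, s \in `[0, B] & gain a c s = 1.
  apply: IVT => //; last by rewrite ge_min gainB orbT le_max ltW.
  apply: continuous_in_subspaceT => s; rewrite inE/= in_itv/= => /andP[s0 _].
  exact: gain_continuous.
rewrite in_itv/= => /andP[s0 _] gs; exists s => //.
rewrite lt_def s0 andbT; apply: contraTneq gain0 => s_eq0.
by rewrite -s_eq0 gs ltxx.
Qed.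

Lemma mul_gain_iteration_cvg {p : R} {u : nat -> R} : c != 0 ->
  0 < p -> gain a c p = 1 ->
  0 < u 0%N -> (forall k, u k.+1 = u k * gain a c (u k)) -> u @ \oo --> p.
Proof.
move=> c0 p0 gp u0 uS.
apply: (@monotone_iteration_cvg _ (fun s => s * gain a c s)) => //.
- by rewrite gp mulr1.
- by move=> s t s0 st; apply: mul_gain_nondecreasing => //; exact: ltW.
- by move=> s s0; apply: cvgM; [exact: cvg_id|exact/gain_continuous/ltW].
- move=> s s0 sp; rewrite ltr_pMr// -gp; exact: gain_decreasing (ltW s0) sp.
- move=> s ps; rewrite gtr_pMr ?(lt_trans p0)// -gp.
  exact: gain_decreasing (ltW p0) ps.
Qed.

End Gain.

(** * The fixed point iteration for a diagonal penalty *)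

Lemma invmx_diag_mul {R : fieldType} {n} (e : 'rV[R]_n) (v : 'cV[R]_n) :
  (forall j, e 0 j != 0) ->
  invmx (diag_mx e) *m v = \col_j (v j 0 / e 0 j).
Proof.
move=> e0.
have e_unit : diag_mx e \in unitmx.
  by rewrite unitmxE det_diag unitfE; apply/prodf_neq0 => j _.
rewrite -[RHS](mulKmx e_unit) mul_diag_mx; congr (_ *m _).
by apply/colP => j; rewrite !mxE mulrC divfK.
Qed.

Section DiagonalPenalty.
Context {R : realType} {n : nat}.
Variables (lambda : R) (d : 'rV[R]_n) (v : 'cV[R]_n).
Hypotheses (lambda_gt0 : 0 < lambda) (d_gt0 : forall j, 0 < d 0 j).

Let U := diag_mx d.
Let T := fpmap lambda U v.
Let a : 'cV[R]_n := \col_j (lambda * d 0 j ^+ 2).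
Let c : 'cV[R]_n := U *m v.
Let gam := gain a c.
Let sz (x : 'cV[R]_n) := l2norm (U *m x).
Let rsp (s : R) : 'cV[R]_n := \col_j (s * (v j 0 / (s + a j 0))).

Let a_gt0 j : 0 < a j 0.
Proof. by rewrite mxE mulr_gt0// exprn_gt0. Qed.

Let U_unit : U \in unitmx.
Proof.
by rewrite unitmxE det_diag unitfE; apply/prodf_neq0 => j _; rewrite gt_eqF.
Qed.

Let sz_gt0 x : (0 < sz x) = (x != 0).
Proof.
rewrite /sz l2norm_gt0; congr (~~ _); apply/eqP/eqP => [Ux0|->];
  last exact: mulmx0.
by rewrite -[x](mulKmx U_unit) Ux0 mulmx0.
Qed.

Let sz_rsp s : 0 <= s -> sz (rsp s) = s * gam s.
Proof.
move=> s0; rewrite /gam /gain -l2normZ// /sz; congr l2norm.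
apply/colP => j; rewrite /c /U !mul_diag_mx !mxE; ring.
Qed.

(** The matrix inverted in [T] is diagonal with entries [(s + a_j) / s], where
    [s = sz x]; nothing else about [x] enters. *)
Let fpmapE x : x != 0 -> T x = rsp (sz x).
Proof.
rewrite -sz_gt0 => s0; rewrite /T /fpmap -/(sz x) tr_diag_mx mulmx_diag.
have -> : 1%:M + (lambda / sz x) *: diag_mx (\row_j (d 0 j * d 0 j)) =
    diag_mx (\row_j ((sz x + a j 0) / sz x)).
  apply/matrixP => i j; rewrite !mxE.
  have [->|_] := eqVneq i j; rewrite ?mulr1n ?mulr0n ?mulr0 ?addr0//.
  by field; rewrite gt_eqF.
have den0 j : sz x + a j 0 != 0 by rewrite gt_eqF// addr_gt0.
rewrite invmx_diag_mul => [|j]; last first.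
  by rewrite mxE mulf_neq0// invr_neq0// gt_eqF.
by apply/colP => j; rewrite !mxE invf_div mulrCA.
Qed.

(** The hypothesis on [v] is exactly a gain larger than [1] at [0], since
    [d_j v_j / (lambda d_j^2) = v_j / (lambda d_j)]. *)
Let gain0 : lambda < l2norm (invmx U *m v) -> 1 < gam 0.
Proof.
rewrite invmx_diag_mul => [|j]; last by rewrite gt_eqF.
rewrite -(ltr_pM2l lambda_gt0 1) mulr1 /gam /gain -l2normZ ?ltW//.
congr (_ < l2norm _); apply/colP => j; rewrite /c /U mul_diag_mx !mxE add0r.
by field; rewrite !gt_eqF.
Qed.

(** The fixed point of [T] is [rsp p] where [p] is the zero of [gam - 1].  For any
    nonzero [y], [T y = y] forces [sz y * gam (sz y) = sz y], so [sz y = p] and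
    [y = rsp p].  Along the iteration [sz] follows [s |-> s * gam s], which tends
    to [p], and [x k.+1 = rsp (sz (x k))] follows by continuity of [rsp]. *)
Lemma fpmap_diag_cvg : lambda < l2norm (invmx U *m v) ->
  exists xstar : 'cV[R]_n,
    [/\ xstar != 0,
        T xstar = xstar,
        (forall y : 'cV[R]_n, y != 0 -> T y = y -> y = xstar) &
        forall x : nat -> 'cV[R]_n,
          x 0%N != 0 -> (forall k : nat, x k.+1 = T (x k)) ->
          (forall k : nat, x k != 0) /\ x k @[k --> \oo] --> xstar].
Proof.
move=> /gain0 gam0; have [p p0 gp] := gain_eq1 a_gt0 gam0.
have c0 : c != 0.
  apply: contraTneq gam0; rewrite /gam /gain => ->.
  rewrite (_ : (\col__ _) = 0) ?l2norm0 -?leNgt//.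
  by apply/colP => j; rewrite !mxE mul0r.
have szT x : x != 0 -> sz (T x) = sz x * gam (sz x).
  by move=> x0; rewrite fpmapE// sz_rsp// l2norm_ge0.
have gam_gt0 s : 0 <= s -> 0 < gam s.
  move=> s0; apply: (@le_lt_trans _ _ (gam (s + 1))); first exact: l2norm_ge0.
  by apply: (gain_decreasing a_gt0 c0 s0); rewrite ltrDl.
have sz_p : sz (rsp p) = p by rewrite sz_rsp ?ltW// /gam gp mulr1.
have rsp_p0 : rsp p != 0 by rewrite -sz_gt0 sz_p.
have T_neq0 x : x != 0 -> T x != 0.
  move=> x0; rewrite -sz_gt0 szT// mulr_gt0 ?sz_gt0// gam_gt0//.
  exact: l2norm_ge0.
exists (rsp p); split=> //.
- by rewrite fpmapE// sz_p.
- move=> y y0 Ty; have s0 : 0 < sz y by rewrite sz_gt0.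
  have gy : gam (sz y) = 1.
    by apply: (mulfI (lt0r_neq0 s0)); rewrite mulr1 -szT// Ty.
  suff -> : p = sz y by rewrite -fpmapE// Ty.
  case: (ltgtP p (sz y)) => // [/(gain_decreasing a_gt0 c0 (ltW p0))|].
    by rewrite gp -/gam gy ltxx.
  move=> /(gain_decreasing a_gt0 c0 (ltW s0)).
  by rewrite gp -/gam gy ltxx.
- move=> x x0 xS.
  have x_neq0 k : x k != 0 by elim: k => // k xk; rewrite xS T_neq0.
  split=> //.
  have sz_cvg : sz (x k) @[k --> \oo] --> p.
    apply: (mul_gain_iteration_cvg a_gt0 c0 p0 gp); rewrite ?sz_gt0// => k.
    by rewrite xS szT.
  rewrite -cvg_shiftS /=.
  under eq_fun => k do rewrite xS fpmapE//.
  apply: cvg_mx_coord => j k; rewrite mxE; under eq_fun do rewrite mxE.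
  apply: cvgM => //; apply: cvgM; first exact: cvg_cst.
  apply: cvgV; first by rewrite gt_eqF// addr_gt0.
  by apply: cvgD => //; exact: cvg_cst.
Qed.

End DiagonalPenalty.

Theorem theorem1p4 (R : realType) (n m : nat) (hn : (1 <= n)%N) (hm : (1 <= m)%N)
    (lambda : R) (hlambda : 0 < lambda)
    (w : 'cV[R]_m) (hw : forall i : 'I_m, 0 < w i 0)
    (G : 'I_m -> {set 'I_n})
    (hG : forall j : 'I_n, exists i : 'I_m, j \in G i)
    (v : 'cV[R]_n) (hv : lambda < l2norm (invmx (Umx w G) *m v)) :
  let T := fpmap lambda (Umx w G) v in
  exists xstar : 'cV[R]_n,
    [/\ xstar != 0,
        T xstar = xstar,
        (forall y : 'cV[R]_n, y != 0 -> T y = y -> y = xstar) &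
        forall x : nat -> 'cV[R]_n,
          x 0%N != 0 -> (forall k : nat, x k.+1 = T (x k)) ->
          (forall k : nat, x k != 0) /\ x k @[k --> \oo] --> xstar].
Proof.
move=> T.
(* The index i rules out the empty vector w, whose norm would be 0. *)
have w_gt0 (i : 'I_m) : 0 < l2norm w.
  rewrite l2norm_gt0; apply: contraTneq (hw i) => ->.
  by rewrite mxE ltxx.
apply: fpmap_diag_cvg => // j; rewrite mxE.
have [i ji] := hG j.
rewrite mulr_gt0 ?(w_gt0 i)// sqrtr_gt0 ltr0n card_gt0.
by apply/set0Pn; exists i; rewrite inE.
Qed.
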